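(* Let $A\in R(\Omega)$, with associated sequences $(a_n),(b_n),(c_n),(d_n)$ having limits $a,b,c,d$, be such that the involution kernel of $A$ based at $x'=1^\infty$ exists, and let $A^*$ be the associated dual potential. Then, writing a point $y\in\Omega^-$ as the sequence $y_1y_2y_3\dots$, for all $n\in\mathbb N$ and $z\in\Omega$: - $A^*(0^\infty)=a$; - $A^*(0^{n+1}1z)=a_{n+1}+(d_{n+1}-d_n)$; - $A^*(01^n0z)=b+(d_1-c)+\sum_{j=2}^n(c_j-c)+(b_n-b)$; - $A^*(01^\infty)=b+(d_1-c)+\sum_{j=2}^\infty(c_j-c)$; - $A^*(1^\infty)=c$; - $A^*(1^{n+1}0z)=c$; - $A^*(10^n1z)=c$; - $A^*(10^\infty)=c$.
   Context: $\mathbb N=\{1,2,\dots\}$, $\Omega=\{0,1\}^{\mathbb N}$ with the product topology. $\Omega^-$ is a copy of $\Omega$ whose points are written $y=(y_1,y_2,\dots)$; $\hat\Omega=\Omega^-\times\Omega$, with points $(y|x)=(\dots,y_2,y_1|x_1,x_2,\dots)$. The Walters family $R(\Omega)$ is the set of continuous $A:\Omega\to\mathbb R$ for which there are convergent real sequences $(a_n),(b_n),(c_n),(d_n)$ such that for all $n\in\mathbb N$, $w\in\Omega$: $A(0^{n+1}1w)=a_{n+1}$, $A(01^n0w)=b_n$, $A(1^{n+1}0w)=c_{n+1}$, $A(10^n1w)=d_n$. The involution kernel of $A$ based at $x'\in\Omega$ is $W(y|x)=\sum_{n\ge1}[A(y_n,\dots,y_1,x_1,x_2,\dots)-A(y_n,\dots,y_1,x'_1,x'_2,\dots)]$;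 it exists if this series converges for every $(y|x)\in\hat\Omega$. The associated dual potential $A^*:\Omega^-\to\mathbb R$ is $$A^*(y)=A(y_1,x_1,x_2,\dots)+W\big((y_2,y_3,\dots)\,|\,(y_1,x_1,x_2,\dots)\big)-W(y|x),$$ whose right-hand side does not depend on $x\in\Omega$. *)

(* Defs.v *)
From HB Require Import structures.
From mathcomp Require Import all_boot all_order all_algebra.
From mathcomp Require Import all_classical all_reals all_analysis.

Set Implicit Arguments.
Unset Strict Implicit.
Unset Printing Implicit Defensive.

Import Order.TTheory GRing.Theory Num.Theory.
Import numFieldNormedType.Exports.

Local Open Scope classical_set_scope.
Local Open Scope ring_scope.

(* Omega = {0,1}^N is the library's [cantor_space] (functions nat -> bool with
   the product topology), where false is the symbol 0 and true the symbol 1.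
   The coordinate x_k (k >= 1) of a point x is [x k.-1].  The same type serves
   for Omega^-: y_1, y_2, ... are [y 0], [y 1], ...                          *)
Definition prepend (s : seq bool) (w : cantor_space) : cantor_space :=
  fun k => if (k < size s)%N then nth false s k else w (k - size s)%N.

(* Binds looser than ++ : s ++ t +++ w is (s ++ t) +++ w. *)
Notation "s +++ w" := (prepend s w) (at level 61, right associativity).

Definition const_pt (e : bool) : cantor_space := fun=> e.

Definition shift (y : cantor_space) : cantor_space := fun k => y k.+1.

(* N = {1, 2, ...}: the values of the sequences at index 0, and of a_ and c_
   at index 1, are unconstrained. *)
Definition walters_sequences (R : realType) (A : cantor_space -> R)
    (a_ b_ c_ d_ : nat -> R) : Prop :=
  forall (n : nat) (w : cantor_space), (0 < n)%N ->
    [/\ A (nseq n.+1 false ++ [:: true] +++ w) = a_ n.+1,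
        A ([:: false] ++ nseq n true ++ [:: false] +++ w) = b_ n,
        A (nseq n.+1 true ++ [:: false] +++ w) = c_ n.+1 &
        A ([:: true] ++ nseq n false ++ [:: true] +++ w) = d_ n].

Definition walters_family (R : realType) : set (cantor_space -> R) :=
  [set A | continuous A /\
    exists a_ b_ c_ d_ : nat -> R,
      [/\ cvgn a_, cvgn b_, cvgn c_ & cvgn d_] /\
      walters_sequences A a_ b_ c_ d_].

(* The word y_n ... y_1. *)
Definition past (y : cantor_space) (n : nat) : seq bool := rev (mkseq y n).

(* The n-th term (n >= 0) is the term of index n + 1 of the series for W. *)
Definition kernel_term (R : realType) (A : cantor_space -> R)
    (x' y x : cantor_space) (n : nat) : R :=
  A (past y n.+1 +++ x) - A (past y n.+1 +++ x').

Definition has_involution_kernel (R : realType) (A : cantor_space -> R)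
    (x' : cantor_space) : Prop :=
  forall y x : cantor_space, cvgn (series (kernel_term A x' y x)).

(* W(y|x); meaningful when [has_involution_kernel A x'] holds. *)
Definition involution_kernel (R : realType) (A : cantor_space -> R)
    (x' y x : cantor_space) : R :=
  limn (series (kernel_term A x' y x)).

Definition dual_expr (R : realType) (A : cantor_space -> R)
    (x' y x : cantor_space) : R :=
  A ([:: y 0%N] +++ x)
  + involution_kernel A x' (shift y) ([:: y 0%N] +++ x)
  - involution_kernel A x' y x.

(* When the kernel exists, [dual_expr A x' y x] does not depend on x
   ([dual_potentialE] below), so that evaluating it at x' is harmless. *)
Definition dual_potential (R : realType) (A : cantor_space -> R)
    (x' y : cantor_space) : R := dual_expr A x' y x'.

Lemma prepend_cat s t w : (s ++ t) +++ w = s +++ (t +++ w).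
Proof.
apply/funext => k; rewrite /prepend size_cat nth_cat.
have [ks|sk] := ltnP k (size s); first by rewrite ltn_addr.
by rewrite -ltn_subLR // subnDA.
Qed.

Lemma pastS y n : past y n.+1 = past (shift y) n ++ [:: y 0%N].
Proof.
rewrite /past /mkseq /= rev_cons -cats1; congr (rev _ ++ _).
by rewrite (iotaDl 1 0) -map_comp.
Qed.

Lemma dual_potentialE (R : realType) (A : cantor_space -> R)
    (x' : cantor_space) : has_involution_kernel A x' ->
  forall y x, dual_potential A x' y = dual_expr A x' y x.
Proof.
move=> hW y.
pose D := fun n => A (past y n.+2 +++ x') - A (past (shift y) n.+1 +++ x').
have key x : series D @ \oo --> dual_expr A x' y x - A ([:: y 0%N] +++ x').
  have h1 := hW (shift y) ([:: y 0%N] +++ x).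
  have h2 : series (kernel_term A x' y x) n.+1 @[n --> \oo] -->
            involution_kernel A x' y x by rewrite (cvg_shiftS (series _)); exact: hW.
  have -> : series D = fun n =>
      (A ([:: y 0%N] +++ x)
       + series (kernel_term A x' (shift y) ([:: y 0%N] +++ x)) n
       - series (kernel_term A x' y x) n.+1) - A ([:: y 0%N] +++ x').
    apply/funext => n; rewrite /series /= big_nat_recl //.
    rewrite opprD addrACA -[X in _ = X + _ - _]/(A _ - (A _ - A _)).
    rewrite subKr addrAC subrr add0r -sumrB; apply: eq_bigr => i _.
    rewrite /D /kernel_term [past y i.+2]pastS !prepend_cat.
    by rewrite opprB [RHS]addrC addrA subrK.
  apply: cvgB; last exact: cvg_cst.
  by apply: cvgB; [apply: cvgD => //; exact: cvg_cst | exact: h2].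
move=> x; apply: (addIr (- A ([:: y 0%N] +++ x'))).
exact: (cvg_unique _ (key x') (key x)).
Qed.

(* Main.v *)
Require Import Defs.
From HB Require Import structures.
From mathcomp Require Import all_boot all_order all_algebra.
From mathcomp Require Import all_classical all_reals all_analysis.

Import Order.TTheory GRing.Theory Num.Theory.
Import numFieldNormedType.Exports.

Local Open Scope classical_set_scope.
Local Open Scope ring_scope.

(** Since W(. | 1^oo) = 0, evaluating the dual potential at x = 1^oo gives
    A*(1 y) = A(1^oo) = c and A*(0 y) = A(0 1^oo) + W(y | 0 1^oo).  A potential
    of the Walters family depends only on the word read up to the first symbol
    that differs from x_2.  Hence, if y starts with a block e^n followed by
    1 - e, the term of W(y | 0 1^oo) at index k vanishes for k > n + 1, since
    both of its points agree up to such a symbol.  The earlier terms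
    telescope for e = 0 and are d_1 - c, c_2 - c, c_3 - c, ... for e = 1; the
    constant points are then reached by continuity. *)

(** * Words, pasts and eventually constant limits *)

Lemma prepend_const n e : nseq n e +++ const_pt e = const_pt e.
Proof.
by apply/funext => k; rewrite /prepend size_nseq nth_nseq; case: (k < n)%N.
Qed.

Lemma shift_prepend1 e w : Defs.shift ([:: e] +++ w) = w.
Proof. by apply/funext => k; rewrite /Defs.shift /prepend /= subn1. Qed.

Lemma past_const e n : past (const_pt e) n = nseq n e.
Proof.
rewrite /past (_ : mkseq _ _ = nseq n e) ?rev_nseq //.
apply: (@eq_from_nth _ e) => [|i]; rewrite size_mkseq ?size_nseq // => i_n.
by rewrite nth_mkseq // nth_nseq i_n.
Qed.

Lemma past_prefix s w n : (n <= size s)%N -> past (s +++ w) n = rev (take n s).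
Proof.
move=> ns; congr rev; apply: (@eq_from_nth _ false) => [|i].
  by rewrite size_mkseq size_takel.
rewrite size_mkseq => i_n; rewrite nth_mkseq // nth_take // /prepend.
by rewrite (leq_trans i_n).
Qed.

Lemma past_prepend s w n : past (s +++ w) (size s + n) = past w n ++ rev s.
Proof.
rewrite /past -rev_cat; congr rev; apply: (@eq_from_nth _ false) => [|i].
  by rewrite size_cat !size_mkseq.
rewrite size_mkseq => i_n; rewrite nth_mkseq // nth_cat /prepend.
case: ltnP => // si; rewrite nth_mkseq //.
by rewrite -(ltn_add2l (size s)) subnKC.
Qed.

Lemma mem_split_const f s : ~~ f \in s ->
  exists n t, s = nseq n f ++ ~~ f :: t.
Proof.
elim: s => // g s IHs; rewrite inE; have [<- _|gf /= sf] := eqVneq (~~ f) g.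
  by exists 0%N, s.
have [n [t ->]] := IHs sf; exists n.+1, t; congr (_ :: _).
by case: f g gf {IHs sf} => [] [].
Qed.

(** In the product topology it suffices that each coordinate is eventually constant: once [n]
    exceeds [k], coordinate [k] lies in [u] or in the block of [e], never in [w n]. *)
Lemma cvg_prepend_nseq u e (w : nat -> cantor_space) :
  (fun n => u ++ nseq n e +++ w n) @ \oo --> (u +++ const_pt e : cantor_space).
Proof.
apply/(pointwise_cvgP (U := nat) (V := bool)) => k; apply: cvg_near_cst.
exists k.+1 => // n /= kn; rewrite prepend_cat /prepend.
case: ltnP => // uk; rewrite size_nseq nth_nseq.
by rewrite (leq_ltn_trans (leq_subr _ _) kn).
Qed.

Lemma limn_series_finite (R : realType) (u : nat -> R) N :
  (forall k, (N <= k)%N -> u k = 0) -> limn (series u) = series u N.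
Proof.
move=> u0; apply: cvg_lim => //; apply: cvg_near_cst; exists N => // n /= Nn.
rewrite /series /= (big_cat_nat (leq0n N) Nn) //= [X in _ + X]big_nat_cond [X in _ + X]big1 ?addr0 //.
by move=> i /andP[/andP[Ni _] _]; exact: u0.
Qed.

(** * Potentials of the Walters family *)

Section walters.
Context {R : realType} {A : cantor_space -> R} {a_ b_ c_ d_ : nat -> R}.
Hypothesis hseq : walters_sequences A a_ b_ c_ d_.

(** The four defining clauses in one form, with [e] the first symbol and [f] the repeated one, so
    that later arguments need not split into cases. *)
Lemma walters_block e f n w : (0 < n)%N ->
  A ((e :: nseq n f) ++ [:: ~~ f] +++ w) =
  match e, f with
  | false, false => a_ n.+1
  | false, true => b_ n
  | true, true => c_ n.+1
  | true, false => d_ n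
  end.
Proof. by case: e f => [] [] n0; have [] := hseq n w n0. Qed.

(** The first occurrence of [~~ f] in [s] closes the block of [f] inside the common word, so both
    values are the same entry of one of the four sequences. *)
Lemma walters_determined e f s w w' : ~~ f \in s ->
  A ((e :: f :: s) +++ w) = A ((e :: f :: s) +++ w').
Proof.
move=> /mem_split_const[n [t ->]].
have E v : (e :: f :: nseq n f ++ ~~ f :: t) +++ v
    = (e :: nseq n.+1 f) ++ [:: ~~ f] +++ (t +++ v).
  by rewrite -prepend_cat -catA.
by rewrite !E !walters_block.
Qed.

(** The point e f^oo is the limit of the points e f^n (1-f) f^oo, on which [A] takes the values of
    the sequence attached to [e] and [f]. *)
Lemma walters_limit e f l : continuous A ->
  match e, f with
  | false, false => a_ | false, true => b_
  | true, true => c_ | true, false => d_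
  end @ \oo --> l -> A ([:: e] +++ const_pt f) = l.
Proof.
move=> cA ul.
have h1 : 
      (fun n => A ([:: e] ++ nseq n f +++ ([:: ~~ f] +++ const_pt f))) @ \oo
    --> A ([:: e] +++ const_pt f).
  by apply: continuous_cvg; [exact: cA | exact: cvg_prepend_nseq].
apply: (cvg_unique _ h1) => //.
(* A block of length [n] carries index [n.+1] when [e] and [f] agree, and index [n] otherwise. *)
apply: (@cvg_trans _ ((match e, f with
  | false, false => fun n => a_ n.+1 | false, true => b_
  | true, true => fun n => c_ n.+1 | true, false => d_
  end) @ \oo)).
  apply: near_eq_cvg; exists 1%N => // n /= n0.
  rewrite -prepend_cat (walters_block e f n (const_pt f) n0).
  by case: (e) (f) => [] [].
by case: e f ul {h1} => [] [] ul //; rewrite (cvg_shiftS _).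
Qed.

End walters.

(** * The dual potential based at 1^oo *)

Section dual_potential.
Context {R : realType} {A : cantor_space -> R}.
Let x1 := const_pt true.

Lemma involution_kernel_base x' y : involution_kernel A x' y x' = 0.
Proof.
rewrite /involution_kernel (@limn_series_finite _ _ 0).
  by rewrite /series /= big_geq.
by move=> k _; rewrite /kernel_term subrr.
Qed.

Lemma dual_potential_true y : dual_potential A x1 ([:: true] +++ y) = A x1.
Proof.
rewrite /dual_potential /dual_expr -[[:: _] +++ x1]/(nseq 1 true +++ _).
by rewrite prepend_const !involution_kernel_base addr0 subr0.
Qed.

(* Terms of the series W(y | 0 1^oo). *)
Definition zero_term y k :=
  A (past y k.+1 ++ [:: false] +++ x1) - A (past y k.+1 +++ x1).

Lemma dual_potential_false y : dual_potential A x1 ([:: false] +++ y) =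
  A ([:: false] +++ x1) + limn (series (zero_term y)).
Proof.
rewrite /dual_potential /dual_expr involution_kernel_base subr0 shift_prepend1.
congr (_ + limn (series _)); apply/funext => k.
by rewrite /kernel_term /zero_term prepend_cat.
Qed.

(** The value of [zero_term y k] for y = e^oo, and also for every y that starts with at least k+1
    symbols [e]. *)
Definition const_term e k :=
  A (nseq k.+1 e ++ [:: false] +++ x1) - A (nseq k.+1 e +++ x1).

Lemma dual_potential_false_const e :
  dual_potential A x1 ([:: false] +++ const_pt e) =
  A ([:: false] +++ x1) + limn (series (const_term e)).
Proof.
rewrite dual_potential_false; congr (_ + limn (series _)).
by apply/funext => k; rewrite /zero_term past_const.
Qed.

Lemma dual_potential_false_block (a_ b_ c_ d_ : nat -> R) e n z :
  walters_sequences A a_ b_ c_ d_ -> (0 < n)%N ->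
  dual_potential A x1 ([:: false] +++ (nseq n e ++ [:: ~~ e] +++ z)) =
  A ([:: false] +++ x1) + \sum_(0 <= k < n) const_term e k
  + (A ((~~ e :: nseq n e) ++ [:: false] +++ x1)
     - A ((~~ e :: nseq n e) +++ x1)).
Proof.
move=> hseq n0; rewrite dual_potential_false -addrA; congr (_ + _).
set y := _ +++ z.
have sz : size (nseq n e ++ [:: ~~ e]) = n.+1 by rewrite size_cat size_nseq addn1.
(* For k < n the past is e^(k+1); for k = n it is (1-e) e^n, which gives the separate last
   summand. *)
rewrite (@limn_series_finite _ _ n.+1) => [|k nk].
  rewrite /series /= big_nat_recr //=; congr (_ + _).
    apply: eq_big_nat => k /andP[_ kn]; rewrite /zero_term past_prefix.
      by rewrite takel_cat ?size_nseq // take_nseq // rev_nseq.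
    by rewrite sz ltnW.
  rewrite /zero_term past_prefix ?sz // take_oversize ?sz //.
  by rewrite rev_cat rev_nseq.
rewrite /zero_term -(subnKC nk) -addnS -sz past_prepend.
rewrite rev_cat rev_nseq sz.
set p := past z _.
have : (0 < size p)%N by rewrite /p size_rev size_mkseq.
(* The past is the nonempty word [p] followed by (1-e) e^n. As n > 0, both symbols occur after the
   first symbol of [p], so the block starting at the second position ends inside the past. *)
case: n n0 @y sz nk @p => // n _ y sz nk p.
case: p => // g p _; apply/eqP; rewrite subr_eq0 prepend_cat; apply/eqP.
case: p => [|h p] /=; apply: (walters_determined hseq).
  by rewrite negbK mem_head.
by rewrite !mem_cat !inE; case: (h) (e) => [] []; rewrite ?orbT.
Qed.

End dual_potential.

Theorem mainTheorem8 (R : realType) (A : cantor_space -> R)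
    (a_ b_ c_ d_ : nat -> R) (a b c d : R)
    (hA : walters_family A)
    (hseq : walters_sequences A a_ b_ c_ d_)
    (ha : a_ @ \oo --> a) (hb : b_ @ \oo --> b)
    (hc : c_ @ \oo --> c) (hd : d_ @ \oo --> d)
    (hW : has_involution_kernel A (const_pt true)) :
  let Astar := dual_potential A (const_pt true) in
  Astar (const_pt false) = a /\
  (forall (n : nat) (z : cantor_space), (0 < n)%N ->
     Astar (nseq n.+1 false ++ [:: true] +++ z)
       = a_ n.+1 + (d_ n.+1 - d_ n)) /\
  (forall (n : nat) (z : cantor_space), (0 < n)%N ->
     Astar ([:: false] ++ nseq n true ++ [:: false] +++ z)
       = b + (d_ 1%N - c) + \sum_(2 <= j < n.+1) (c_ j - c) + (b_ n - b)) /\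
  (cvgn (fun n : nat => \sum_(2 <= j < n) (c_ j - c)) /\
   Astar ([:: false] +++ const_pt true)
     = b + (d_ 1%N - c) + \big[+%R/0]_(2 <= j <oo) (c_ j - c)) /\
  Astar (const_pt true) = c /\
  (forall (n : nat) (z : cantor_space), (0 < n)%N ->
     Astar (nseq n.+1 true ++ [:: false] +++ z) = c) /\
  (forall (n : nat) (z : cantor_space), (0 < n)%N ->
     Astar ([:: true] ++ nseq n false ++ [:: true] +++ z) = c) /\
  Astar ([:: true] +++ const_pt false) = c.
Proof.
have [cA _] := hA; move=> Astar.
pose x1 := const_pt true.
have x1E : [:: true] +++ x1 = x1 := prepend_const 1 true.
have Ab : A ([:: false] +++ x1) = b by exact: (walters_limit hseq).
have Ac : A x1 = c by rewrite -x1E; exact: (walters_limit hseq).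
(* The term of index k is A(0^(k+2) 1^oo) - A(0^(k+1) 1^oo): the sum telescopes from A(0 1^oo) = b
   to A(0^(n+1) 1^oo). *)
have sum0 n : (0 < n)%N ->
    \sum_(0 <= k < n) const_term (A := A) false k = a_ n.+1 - b.
  move=> n0; rewrite (@telescope_sumr_eq _ _ _
    (fun k => A (nseq k.+1 false +++ x1))) // => [|k _].
    by rewrite Ab -(walters_block hseq false false n x1) // prepend_cat x1E.
  by rewrite /const_term -[[:: false]]/(nseq 1 false) -nseqD addn1.
have termE k : const_term (A := A) true k
    = A (nseq k.+1 true ++ [:: false] +++ x1) - c.
  by rewrite /const_term prepend_const Ac.
(* The point 1 0 1^oo at k = 0 gives [d_ 1]; for k > 0 the point 1^(k+1) 0 1^oo gives [c_ k.+1],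
   whence j = k+1. *)
have sum1 n : \sum_(0 <= k < n.+1) const_term (A := A) true k
    = (d_ 1%N - c) + \sum_(2 <= j < n.+2) (c_ j - c).
  rewrite big_ltn // [X in _ + X]big_add1 /= [in RHS]big_add1 /= big_add1 /=.
  rewrite termE; congr (_ - _ + _).
    rewrite -(walters_block hseq true false 1 x1) //.
    by rewrite [in RHS]prepend_cat x1E.
  apply: eq_big_nat => k _.
  by rewrite termE -(walters_block hseq true true k.+1 x1).
have true_c y : Astar ([:: true] +++ y) = c.
  by rewrite /Astar dual_potential_true.
split; last split; last split; last split; last split; last split; last split.
- rewrite -(prepend_const 1 false) /Astar dual_potential_false_const Ab.
  suff T : series (const_term (A := A) false) @ \oo --> a - b.
    by rewrite (cvg_lim _ T) // subrKC.
  apply: (@cvg_trans _ ((fun n => a_ n.+1 - b) @ \oo)).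
    by apply: near_eq_cvg; exists 1%N => // n /= n0; rewrite -sum0.
  by apply: cvgB; [rewrite (cvg_shiftS a_) | exact: cvg_cst].
- move=> n z n0.
  have -> : nseq n.+1 false ++ [:: true] +++ z
      = [:: false] +++ (nseq n false ++ [:: ~~ false] +++ z).
    by rewrite -[RHS]prepend_cat.
  rewrite /Astar (dual_potential_false_block _ _ _ _ _ _ _ hseq n0) Ab sum0 // subrKC.
  (* What remains is A(1 0^(n+1) 1^oo) - A(1 0^n 1^oo). *)
  congr (_ + (_ - _)).
    rewrite -(walters_block hseq true false n.+1 x1) // [in RHS]prepend_cat x1E.
    by rewrite -[[:: false]]/(nseq 1 false) cat_cons -nseqD addn1.
  by rewrite -(walters_block hseq true false n x1) // [in RHS]prepend_cat x1E.
- move=> n z n0.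
  have -> : [:: false] ++ nseq n true ++ [:: false] +++ z
      = [:: false] +++ (nseq n true ++ [:: ~~ true] +++ z).
    by rewrite -[RHS]prepend_cat.
  rewrite /Astar (dual_potential_false_block _ _ _ _ _ _ _ hseq n0) Ab.
  rewrite (walters_block hseq false true n x1 n0).
  rewrite -[~~ true :: nseq n true]/([:: false] ++ nseq n true) prepend_cat.
  by rewrite prepend_const Ab; case: n n0 => [|n] // _; rewrite sum1 !addrA.
- set S := fun n => \sum_(2 <= j < n) (c_ j - c).
  pose L := limn (series (const_term (A := A) true)).
  (* Convergence of the sum of the c_j - c comes from the existence of the kernel at the point with
     y = 1^oo and x = 0 1^oo. *)
  have cvgT : series (const_term (A := A) true) @ \oo --> L.
    rewrite /L (_ : const_term true = kernel_term A x1 x1 ([:: false] +++ x1)).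
      exact: hW.
    apply/funext => k.
    by rewrite /kernel_term /const_term past_const prepend_cat.
  have cvgS : S @ \oo --> L - (d_ 1%N - c).
    (* [S (n + 2)] is the partial sum of n+1 terms with its k = 0 term [d_ 1 - c] removed. *)
    rewrite -(cvg_shiftn 2 S _).
    have -> : (fun n => S (n + 2)%N)
        = fun n => series (const_term (A := A) true) n.+1 - (d_ 1%N - c).
      apply/funext => n; rewrite /series /= sum1 addn2.
      by rewrite addrAC subrr add0r.
    by apply: cvgB; [rewrite (cvg_shiftS (series _)); exact: cvgT | exact: cvg_cst].
  split; first exact: cvgP cvgS.
  rewrite (cvg_lim _ cvgS) // /Astar dual_potential_false_const Ab -/L.
  by rewrite -addrA subrKC.
- by have := true_c x1; rewrite x1E.
- move=> n z _.
  by rewrite -(true_c (nseq n true ++ [:: false] +++ z)) -prepend_cat.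
- move=> n z _.
  by rewrite -(true_c (nseq n false ++ [:: true] +++ z)) -prepend_cat.
- exact: true_c.
Qed.
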